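(* There exists a countable linearly ordered locally compact Polish topological semilattice $X$ which cannot be topologically embedded into $\mathbb{N}^{\mathbb{N}}$.
   Context: A semilattice is a commutative semigroup of idempotents; it is ordered by $e\le f$ if and only if $ef=e$, and ''linearly ordered'' means that this order is linear. A topological semilattice is a semilattice with a topology for which the semilattice operation is continuous. $\mathbb{N}^{\mathbb{N}}$ is the monoid of all functions $\mathbb{N}\to\mathbb{N}$ under composition (functions act on the right and compose from left to right), with the product topology arising from the discrete topology on $\mathbb{N}$. A topological embedding of a topological semigroup $S$ into a topological semigroup $T$ is an injective homomorphism $\phi:S\to T$ such that $\phi$ and $\phi^{-1}:(S)\phi\to S$ are continuous, where $(S)\phi$ has the subspace topology. *)

(* Defs.v *)
From HB Require Import structures.
From mathcomp Require Import all_boot all_order all_algebra.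
From mathcomp Require Import all_classical all_reals topology.

Set Implicit Arguments.
Unset Strict Implicit.
Unset Printing Implicit Defensive.

Import Order.TTheory GRing.Theory Num.Theory.
Local Open Scope classical_set_scope.
Local Open Scope ring_scope.

HB.structure Definition PreTopologicalSemigroup :=
  {S of Topological S & Semigroup S}.

HB.mixin Record PreTopologicalSemigroup_isTopologicalSemigroup S
    & PreTopologicalSemigroup S := {
  mulg_continuous : continuous (fun xy : S * S => (xy.1 * xy.2)%g)
}.

#[short(type="topologicalSemigroupType")]
HB.structure Definition TopologicalSemigroup :=
  {S of PreTopologicalSemigroup S &
        PreTopologicalSemigroup_isTopologicalSemigroup S}.

HB.mixin Record Semigroup_isSemilattice S & Semigroup S := {
  mulgC : commutative (@monoid.mul S);
  mulgg : idempotent_op (@monoid.mul S)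
}.

#[short(type="topologicalSemilatticeType")]
HB.structure Definition TopologicalSemilattice :=
  {S of TopologicalSemigroup S & Semigroup_isSemilattice S}.

Definition semilattice_le (S : semigroupType) : rel S :=
  fun e f => (e * f)%g == e.

Definition linearly_ordered (S : semigroupType) := total (@semilattice_le S).

Record is_metric (R : realType) (X : Type) (d : X -> X -> R) : Prop := {
  is_metric_ge0 : forall x y, 0 <= d x y;
  is_metric_eq0 : forall x y, d x y = 0 <-> x = y;
  is_metric_sym : forall x y, d x y = d y x;
  is_metric_triangle : forall x y z, d x z <= d x y + d y z
}.

Definition metric_generates_topology (R : realType) (X : topologicalType)
    (d : X -> X -> R) :=
  forall A : set X, open A <->
    forall x, A x -> exists2 e : R, 0 < e & [set y | d x y < e] `<=` A.

Definition metric_complete (R : realType) (X : Type) (d : X -> X -> R) :=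
  forall u : nat -> X,
    (forall e : R, 0 < e -> exists N, forall m n,
       (N <= m)%N -> (N <= n)%N -> d (u m) (u n) < e) ->
    exists l : X, forall e : R, 0 < e -> exists N, forall n,
       (N <= n)%N -> d (u n) l < e.

Definition completely_metrizable (R : realType) (X : topologicalType) :=
  exists d : X -> X -> R,
    [/\ is_metric d, metric_generates_topology d & metric_complete d].

Definition separable (X : topologicalType) :=
  exists2 D : set X, countable D & dense D.

Definition polish (R : realType) (X : topologicalType) :=
  separable X /\ completely_metrizable R X.

(* The continuity of the inverse is quantified over all total extensions of
   phi^-1 : (S)phi -> S to T; a bare [exists psi] would exclude the case of an
   empty S. *)
Record topological_embedding (S T : topologicalSemigroupType) (phi : S -> T) :
    Prop := {
  topological_embedding_inj : injective phi;
  topological_embedding_morph : {morph phi : x y / (x * y)%g};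
  topological_embedding_cts : continuous phi;
  topological_embedding_inv_cts :
    forall psi : T -> S, cancel phi psi ->
      {within range phi, continuous psi}
}.

(* The monoid of all functions nat -> nat, acting on the right, so that f * g is
   "f, then g"; the alias prevents the other structures on nat -> nat from
   being inferred. *)
Definition natfun : Type := nat -> nat.

HB.instance Definition _ := Topological.copy natfun {ptws nat -> nat}.

Definition natfun_mul (f g : natfun) : natfun := fun n => g (f n).

Fact natfun_mulA : associative natfun_mul. Proof. by []. Qed.
Fact natfun_mul1 : left_id (id : natfun) natfun_mul. Proof. by []. Qed.
Fact natfun_mulr1 : right_id (id : natfun) natfun_mul. Proof. by []. Qed.

HB.instance Definition _ :=
  isMonoid.Build natfun natfun_mulA natfun_mul1 natfun_mulr1.

Fact natfun_eval_near (f : natfun) (n : nat) :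
  \forall h \near f, (h : natfun) n = f n.
Proof.
have /= := @proj_continuous nat (fun=> nat) n f [set f n].
by apply; rewrite nbhs_principalE.
Qed.

Fact natfun_mul_continuous :
  continuous (fun xy : natfun * natfun => (xy.1 * xy.2)%g).
Proof.
move=> [f g]; apply/cvg_sup => n A [B [[C oC <-] CB BA]].
exists ([set h : natfun | h n = f n], [set h : natfun | h (f n) = g (f n)]).
  by split; exact: natfun_eval_near.
case=> h k /= [hn kfn]; apply: BA => /=.
have -> : (h * k)%g n = (f * g)%g n :> nat by rewrite -[LHS]/(k (h n)) hn kfn.
exact: CB.
Qed.

HB.instance Definition _ :=
  PreTopologicalSemigroup_isTopologicalSemigroup.Build natfun
    natfun_mul_continuous.

(* Main.v *)
Require Import Defs.
From HB Require Import structures.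
From mathcomp Require Import all_boot all_order all_algebra.
From mathcomp Require Import all_classical all_reals topology.

Set Implicit Arguments.
Unset Strict Implicit.
Unset Printing Implicit Defensive.

Import Order.TTheory GRing.Theory Num.Theory.

Local Open Scope classical_set_scope.

(** The counterexample is the chain 0 < 1 < 2 < ... < top under minimum, with
    every natural number isolated and the neighbourhoods of top generated by
    the sets of all sufficiently large even numbers together with top: the even
    numbers converge to top, while the odd numbers form a closed discrete set.

    Minimum is continuous, because a minimum with a fixed number is constant
    near top, and the minimum of two elements is always one of the two.  The
    even numbers with top form a compact clopen set, so the space is locally
    compact.  It is completely metrizable: with weight 0 at top, 1 at the odd
    numbers and 1/(n+1) at an even n, the distance of two distinct points is the
    maximum of their weights.

    What fails is local convexity, which every subsemigroup of nat -> nat that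
    is a chain must have.  If [phi] is a homomorphism into nat -> nat, then for
    each k the fibres of the map sending x to [phi x k] are order-convex
    ([natfun_fiber_convex]).  When [phi] is continuous, [phi x k = phi top k]
    for all large even x, so convexity gives the same for all large odd x; hence
    all of [phi 0, phi 1, phi 2, ...] converges to [phi top]
    ([chain_top_limit_natfun]).  If the inverse of [phi] were continuous, the
    odd numbers would converge to top. *)

(** * The chain and its topology *)

Definition chain : Type := option nat.

HB.instance Definition _ := Choice.copy chain (option nat).

Definition chain_top : chain := None.

Definition chain_nat (n : nat) : chain := Some n.

Lemma countable_chain : countable [set: chain].
Proof. exact: (@countableP (option nat)). Qed.

Definition chain_mul (x y : chain) : chain :=
  match x, y with
  | None, _ => y
  | _, None => x
  | Some m, Some n => Some (minn m n)
  end.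

Fact chain_mulA : associative chain_mul.
Proof. by move=> [m|] [n|] [k|] //=; rewrite minnA. Qed.

HB.instance Definition _ := isSemigroup.Build chain chain_mulA.

Fact chain_mulC : commutative chain_mul.
Proof. by move=> [m|] [n|] //=; rewrite minnC. Qed.

Fact chain_mulxx : idempotent_op chain_mul.
Proof. by move=> [m|] //=; rewrite minnn. Qed.

Arguments chain_mul : simpl never.

Lemma chain_linear : linearly_ordered chain.
Proof.
rewrite /linearly_ordered /semilattice_le /monoid.mul /= /chain_mul.
case=> [m|] [n|]; rewrite ?eqxx ?orbT//.
by case: leqP => _; rewrite eqxx ?orbT.
Qed.

Definition chain_open (A : set chain) :=
  A chain_top -> \forall n \near \oo, A (chain_nat n.*2).

Fact chain_openT : chain_open setT.
Proof. by move=> _; exact: filterT. Qed.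

Fact chain_openI : setI_closed chain_open.
Proof. by move=> A B oA oB [/oA Ap /oB Bp]; exact: filterI. Qed.

Fact chain_open_bigU (I : Type) (f : I -> set chain) :
  (forall i, chain_open (f i)) -> chain_open (\bigcup_i f i).
Proof.
by move=> fo [i _ /fo]; apply: filterS => n fin; exists i.
Qed.

HB.instance Definition _ :=
  isOpenTopological.Build chain chain_openT chain_openI chain_open_bigU.

Lemma chain_openE (A : set chain) : open A = chain_open A.
Proof. by []. Qed.

Lemma nbhs_chain_nat (n : nat) (A : set chain) :
  A (chain_nat n) -> nbhs (chain_nat n) A.
Proof.
move=> An; rewrite nbhsE; exists [set chain_nat n]; last by move=> _ ->.
by split.
Qed.

Lemma nbhs_chain_top (A : set chain) :
  nbhs chain_top A <->
  A chain_top /\ \forall n \near \oo, A (chain_nat n.*2).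
Proof.
rewrite nbhsE; split=> [[B [oB Bp] BA]|[Ap An]].
  by split; [exact: BA | apply: filterS (oB Bp) => n; exact: BA].
by exists A => //; split=> // _.
Qed.

Lemma chain_mul_continuous :
  continuous (fun xy : chain * chain => (xy.1 * xy.2)%g).
Proof.
move=> [[m|] [n|]] A; rewrite /monoid.mul /= => nA.
- exists ([set chain_nat m], [set chain_nat n]) => /=.
    by split; exact: nbhs_chain_nat.
  by case=> _ _ [/= -> ->]; exact: (nbhs_singleton nA).
- exists ([set chain_nat m], [set y | chain_mul (chain_nat m) y = chain_nat m]).
    split; first exact: nbhs_chain_nat.
    apply/nbhs_chain_top; split=> //=.
    exists m => // k /= mk; congr Some; apply/minn_idPl.
    by rewrite (leq_trans mk)// -addnn leq_addr.
  by case=> _ y [/= -> my]; rewrite my /=; exact: (nbhs_singleton nA).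
- exists ([set x | chain_mul x (chain_nat n) = chain_nat n], [set chain_nat n]).
    split; last exact: nbhs_chain_nat.
    apply/nbhs_chain_top; split=> //=.
    exists n => // k /= nk; congr Some; apply/minn_idPr.
    by rewrite (leq_trans nk)// -addnn leq_addr.
  by case=> x _ [/= xn ->]; rewrite xn; exact: (nbhs_singleton nA).
- exists (A, A) => //=.
  by case=> [[m|] [n|]] [] //= Am An; rewrite /chain_mul /minn; case: ifP.
Qed.

HB.instance Definition _ :=
  PreTopologicalSemigroup_isTopologicalSemigroup.Build chain
    chain_mul_continuous.

HB.instance Definition _ := Semigroup_isSemilattice.Build chain
  chain_mulC chain_mulxx.

(** * Local compactness *)

Definition chain_even : set chain :=
  [set x | if x is Some n then ~~ odd n else true].

Lemma nbhs_chain_even : nbhs chain_top chain_even.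
Proof.
by apply/nbhs_chain_top; split=> //; near=> n; rewrite /chain_even/= odd_double.
Unshelve. all: by end_near. Qed.

Lemma closed_chain_even : closed chain_even.
Proof. by rewrite -openC chain_openE => /(_ erefl). Qed.

Lemma chain_even_cofinite (A : set chain) :
  nbhs chain_top A -> finite_set (chain_even `\` A).
Proof.
case/nbhs_chain_top=> Ap [N _ AN].
apply: (@sub_finite_set _ _ (chain_nat @` `I_N.*2)).
  2: exact/finite_image/finite_II.
case=> [n|] [/= ev nA]; last by [].
exists n => //=; rewrite ltnNge; apply/negP => Nn.
apply: nA; rewrite -(even_halfK ev); apply: AN => /=.
by rewrite -leq_double even_halfK.
Qed.

(** A filter on the even points that does not cluster at the top lives on a
    finite set. *)
Lemma compact_chain_even : compact chain_even.
Proof.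
move=> F FF FE.
have [Fp|] := pselect (cluster F chain_top); first by exists chain_top.
move=> nFp.
have [A [B [FA nB AB]]] : exists A B, [/\ F A, nbhs chain_top B & A `<=` ~` B].
  apply: contra_notP nFp => nAB A B FA nB.
  apply: contrapT => AB0; apply: nAB; exists A, B; split=> // x Ax Bx.
  by apply: AB0; exists x.
have [x [[Ex _] Fx]] : (chain_even `\` B) `&` cluster F !=set0.
  apply: finite_compact (chain_even_cofinite nB) _ _ _.
  by apply: filterS2 FE FA => x Ex /AB.
by exists x.
Qed.

Lemma locally_compact_chain : locally_compact [set: chain].
Proof.
move=> [n|] _; rewrite /prop_near1 /= withinET.
  exists [set chain_nat n]; first exact: nbhs_chain_nat.
  split; first exact: compact_set1.
  rewrite -openC chain_openE => _; exists n.+1 => // m /= nm [mn].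
  by move: nm; rewrite -mn ltnNge -addnn leq_addr.
exists chain_even; first exact: nbhs_chain_even.
by split; [exact: compact_chain_even | exact: closed_chain_even].
Qed.

(** * Complete metrizability *)

(** This ultrametric makes every point of positive weight isolated, at distance
    at least its own weight from all others, and makes the weight the distance
    to a point of weight zero. *)
Definition weight_dist (R : realType) (T : eqType) (w : T -> R) (x y : T) : R :=
  if x == y then 0%R else Num.max (w x) (w y).

Lemma weight_dist_metric (R : realType) (T : eqType) (w : T -> R) (p : T) :
  (forall x, (0 <= w x)%R) -> (forall x, w x = 0%R -> x = p) ->
  is_metric (weight_dist w).
Proof.
move=> w0 wp; rewrite /weight_dist; split.
- by move=> x y; case: ifP => // _; rewrite le_max w0.
- move=> x y; case: eqP => // xy; split=> // m0.
  have wx : w x = 0%R.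
    by apply/eqP; rewrite eq_le w0 -m0 le_max lexx.
  have wy : w y = 0%R.
    by apply/eqP; rewrite eq_le w0 -m0 le_max lexx orbT.
  by rewrite (wp x wx) (wp y wy).
- by move=> x y; rewrite eq_sym maxC.
- move=> x y z; case: (eqVneq x y) => [->|xy]; first by rewrite add0r.
  case: (eqVneq y z) => [<-|yz]; first by rewrite (negPf xy) addr0.
  have wxy : (0 <= Num.max (w x) (w y))%R by rewrite le_max w0.
  have wyz : (0 <= Num.max (w y) (w z))%R by rewrite le_max w0.
  case: ifP => _; first exact: addr_ge0.
  rewrite ge_max; apply/andP; split.
    by rewrite ler_wpDr// le_max lexx.
  by rewrite ler_wpDl// le_max lexx orbT.
Qed.

(** Either the weights along a Cauchy sequence tend to zero, and it converges to
    the point [p] of weight zero, or terms of weight bounded below recur, and such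
    a term can only be close to later ones by being equal to them. *)
Lemma weight_dist_complete (R : realType) (T : eqType) (w : T -> R) (p : T) :
  w p = 0%R -> metric_complete (weight_dist w).
Proof.
move=> wp u uC.
have [wu|] := pselect (forall e : R, (0 < e)%R ->
    exists N, forall n, (N <= n)%N -> (w (u n) < e)%R).
  exists p => e e0; have [N uN] := wu e e0; exists N => n /uN une.
  rewrite /weight_dist wp; case: ifP => // _.
  by rewrite gt_max une.
move=> /existsNP[e /not_implyP[e0 /forallNP nwu]].
have [N uN] := uC e e0.
have /existsNP[n /not_implyP[Nn /negP]] := nwu N; rewrite -leNgt => eun.
exists (u n) => d d0; exists N => m Nm.
have := uN m n Nm Nn; rewrite /weight_dist; case: eqP => // _.
by rewrite gt_max [X in _ && X]ltNge eun andbF.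
Qed.

Lemma weight_dist_generates (R : realType) (X : topologicalType) (w : X -> R)
    (p : X) :
  w p = 0%R -> (forall x, (0 <= w x)%R) -> (forall x, w x = 0%R -> x = p) ->
  (forall A : set X, open A <->
     (A p -> exists2 e : R, (0 < e)%R & [set y | (w y < e)%R] `<=` A)) ->
  metric_generates_topology (weight_dist w).
Proof.
move=> wp w0 w0p oE A; rewrite oE /weight_dist; split=> [Ap x Ax|Ax].
  have [xp|xp] := eqVneq x p.
    move: Ax; rewrite xp => /Ap[e e0 eA]; exists e => // y /=.
    case: eqP => [<- _|_]; first by apply: eA => /=; rewrite wp.
    by rewrite gt_max => /andP[_ /eA].
  exists (w x).
    by rewrite lt_neqAle w0 andbT; apply: contraNneq xp => /esym/w0p/eqP.
  by move=> y /=; case: eqP => [<-//|_]; rewrite gt_max ltxx.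
move=> /Ax[e e0 eA]; exists e => // y /= ye; apply: eA => /=.
by case: ifP => // _; rewrite gt_max wp e0.
Qed.

(** Odd points get weight 1, which keeps them away from the top. *)
Definition chain_weight (R : realType) (x : chain) : R :=
  match x with
  | None => 0%R
  | Some n => if odd n then 1%R else (n.+1%:R^-1)%R
  end.

Lemma chain_weight_ge0 (R : realType) (x : chain) : (0 <= chain_weight R x)%R.
Proof. by case: x => [n|] //=; case: ifP => // _; rewrite invr_ge0. Qed.

Lemma chain_weight_eq0 (R : realType) (x : chain) :
  chain_weight R x = 0%R -> x = chain_top.
Proof.
case: x => [n|] //=; case: ifP => _ /eqP; first by rewrite oner_eq0.
by rewrite invr_eq0 pnatr_eq0.
Qed.

Lemma chain_weight_open (R : realType) (A : set chain) :
  open A <-> (A chain_top ->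
    exists2 e : R, (0 < e)%R & [set y | (chain_weight R y < e)%R] `<=` A).
Proof.
rewrite chain_openE; split=> [oA Ap|eA Ap].
  have [N _ AN] := oA Ap.
  exists (N.*2.+1%:R^-1)%R; first by rewrite invr_gt0.
  move=> [n|//] /=; case: ifPn => [_|ev].
    by rewrite ltNge invf_le1 ?ltr0n// ler1n.
  rewrite ltf_pV2 ?posrE// ltr_nat ltnS => Nn.
  rewrite -(even_halfK ev); apply: AN => /=.
  by rewrite -leq_double even_halfK// ltnW.
have [e e0 {}eA] := eA Ap.
exists (Num.bound e^-1) => // n /= en; apply: eA => /=.
rewrite odd_double invf_plt ?posrE//.
have /archi_boundP : (0 <= e^-1)%R by rewrite invr_ge0 ltW.
move=> /lt_le_trans; apply; rewrite ler_nat (leq_trans en)//.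
by rewrite (leq_trans _ (leqnSn _))// -addnn leq_addr.
Qed.

Lemma polish_chain (R : realType) : polish R chain.
Proof.
split.
  exists setT; first exact: countable_chain.
  by move=> O [x Ox] _; exists x.
exists (weight_dist (chain_weight R)); split.
- exact: weight_dist_metric (@chain_weight_ge0 R) (@chain_weight_eq0 R).
- apply: (weight_dist_generates (p := chain_top)) => //.
  + exact: chain_weight_ge0.
  + exact: chain_weight_eq0.
  + exact: chain_weight_open.
- exact: (@weight_dist_complete _ _ _ chain_top).
Qed.

(** * Non-embeddability *)

(** Apply [phi y] to both sides of [phi x k = phi z k]: on the right it gives
    [phi (z * y) k = phi y k], on the left [phi (x * y) k = phi x k]. *)
Lemma natfun_fiber_convex (S : semigroupType) (phi : S -> natfun) :
  {morph phi : x y / (x * y)%g} -> forall (x y z : S) (k : nat),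
  (x * y)%g = x -> (z * y)%g = y -> phi x k = phi z k -> phi y k = phi z k.
Proof.
move=> phiM x y z k xy zy xz.
have -> : phi y k = phi y (phi z k) by rewrite -{1}zy phiM.
by rewrite -xz -[in RHS]xy phiM.
Qed.

(** Continuity only speaks of the even points; convexity of the fibres carries
    the convergence over to the odd points squeezed between them and the top. *)
Lemma chain_top_limit_natfun (phi : chain -> natfun) :
  {morph phi : x y / (x * y)%g} -> continuous phi ->
  phi (chain_nat n) @[n --> \oo] --> phi chain_top.
Proof.
move=> phiM phic; apply/cvg_sup => k A [B [[C oC <-] CB BA]].
have [_ [N _ phiN]] :=
  (nbhs_chain_top _).1 (phic chain_top _ (natfun_eval_near _ k)).
exists N.*2 => // n /= Nn; apply: BA => /=.
suff -> : phi (chain_nat n) k = phi chain_top k by [].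
apply: (natfun_fiber_convex phiM (x := chain_nat N.*2)) => //.
  by congr Some; apply/minn_idPl.
exact: (phiN N (leqnn N)).
Qed.

(** Pulling the even points back along the inverse of an embedding would give
    a neighbourhood of [phi chain_top] in the range, and the sequence
    [phi (chain_nat n)] would eventually stay in it, odd [n] included. *)
Lemma chain_not_embeddable (phi : chain -> natfun) :
  ~ topological_embedding phi.
Proof.
case=> phiI phiM phic psic.
pose psi (f : natfun) : chain := xget chain_top [set x | phi x = f].
have phiK : cancel phi psi.
  move=> x; apply: phiI.
  by apply: (@xgetPex _ chain_top [set y | phi y = phi x]); exists x.
have /subspace_continuousP psic' := psic psi phiK.
have psi_even : \forall f \near phi chain_top,
    range phi f -> chain_even (psi f).
  apply: (psic' (phi chain_top)); first exact: imageT.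
  rewrite -[X in nbhs X]/(psi (phi chain_top)) phiK.
  exact: nbhs_chain_even.
have [N _ evenN] := chain_top_limit_natfun phiM phic psi_even.
have N_odd : (N <= N.*2.+1)%N by rewrite -addnn leqW ?leq_addr.
have := evenN N.*2.+1 N_odd (imageT _ _).
by rewrite phiK /chain_even /= odd_double.
Qed.

Theorem proposition4p7 (R : realType) :
  exists X : topologicalSemilatticeType,
    [/\ countable [set: X], linearly_ordered X, locally_compact [set: X],
        polish R X
      & ~ exists phi : X -> natfun, topological_embedding phi].
Proof.
exists (chain : topologicalSemilatticeType); split.
- exact: countable_chain.
- exact: chain_linear.
- exact: locally_compact_chain.
- exact: polish_chain.
- by case=> phi; exact: chain_not_embeddable.
Qed.
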